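(* Let $p$ be an odd prime, let $n\ge 1$, and let $G=\mathbb Z^n\rtimes \mathcal C_p$ be a non-abelian semidirect product. Then $G$ has a non-trivial weak Cayley table map, i.e. $\mathcal W(G)\setminus \mathcal W_0(G)\neq\emptyset$.
   Context: For a group $G$, $\sim$ denotes conjugacy in $G$. The weak Cayley table group $\mathcal W(G)$ is the group (under composition) of all bijections $f:G\to G$ such that $f(g_1g_2)\sim f(g_1)f(g_2)$ for all $g_1,g_2\in G$. It contains $\operatorname{Aut}(G)$ and the inversion map $\iota:g\mapsto g^{-1}$; $\mathcal W_0(G)=\langle \operatorname{Aut}(G),\iota\rangle$. Elements of $\mathcal W(G)\setminus \mathcal W_0(G)$ are called non-trivial. $\mathcal C_m$ denotes the cyclic group of order $m$. *)

(* Defs.v *)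
From HB Require Import structures.
From mathcomp Require Import all_boot all_order all_fingroup all_algebra.

Set Implicit Arguments.
Unset Strict Implicit.
Unset Printing Implicit Defensive.

Local Open Scope group_scope.

(* A homomorphism H -> Aut(K); each [phi h] is bijective, with inverse
   [phi h^-1]. *)
Record autAction (H K : groupType) := AutAction {
  aut_act :> H -> K -> K;
  aut_act_morph : forall h, {morph aut_act h : x y / x * y};
  aut_act1 : aut_act 1 =1 id;
  aut_actM : forall h1 h2, aut_act (h1 * h2) =1 aut_act h1 \o aut_act h2
}.

(* The external semidirect product of K by H.  A record rather than a bare
   pair, since pairs carry the direct product structure. *)
Record semidirect (H K : groupType) (phi : autAction H K) := SemiDirect {
  sd_ker : K;
  sd_top : H
}.

Section SemiDirectGroup.

Variables (H K : groupType) (phi : autAction H K).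
Local Notation G := (semidirect phi).
Implicit Types u v w : G.

Definition pair_of_sd u := (sd_ker u, sd_top u).
Definition sd_of_pair (x : K * H) : G := SemiDirect phi x.1 x.2.

Lemma pair_of_sdK : cancel pair_of_sd sd_of_pair.
Proof. by case. Qed.

HB.instance Definition _ := Choice.copy G (can_type pair_of_sdK).

Definition sd_one : G := SemiDirect phi 1 1.
Definition sd_mul u v : G :=
  SemiDirect phi (sd_ker u * phi (sd_top u) (sd_ker v)) (sd_top u * sd_top v).
Definition sd_inv u : G :=
  SemiDirect phi (phi (sd_top u)^-1 (sd_ker u)^-1) (sd_top u)^-1.

Lemma aut_act_one h : phi h 1 = 1.
Proof. by apply: (mulgI (phi h 1)); rewrite -aut_act_morph !mulg1. Qed.

Lemma sd_mulA : associative sd_mul.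
Proof.
by move=> u v w; rewrite /sd_mul /= aut_act_morph aut_actM /= !mulgA.
Qed.

Lemma sd_mul1 : left_id sd_one sd_mul.
Proof. by case=> k h; rewrite /sd_mul /= aut_act1 !mul1g. Qed.

Lemma sd_mulr1 : right_id sd_one sd_mul.
Proof. by case=> k h; rewrite /sd_mul /= aut_act_one !mulg1. Qed.

Lemma sd_mulV : left_inverse sd_one sd_inv sd_mul.
Proof.
by case=> k h; rewrite /sd_mul /= -aut_act_morph !mulVg aut_act_one.
Qed.

Lemma sd_mulrV : right_inverse sd_one sd_inv sd_mul.
Proof.
case=> k h; rewrite /sd_mul /= -[phi h _]/((phi h \o phi h^-1) _) -aut_actM.
by rewrite mulgV aut_act1 /= mulgV.
Qed.

HB.instance Definition _ :=
  isGroup.Build G sd_mulA sd_mul1 sd_mulr1 sd_mulV sd_mulrV.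

End SemiDirectGroup.

Definition conjugate (G : groupType) (x y : G) : Prop := exists z : G, y = x ^ z.

Definition abelian_group (G : groupType) : Prop := forall x y : G, commute x y.

Definition weak_cayley_map (G : groupType) (f : G -> G) : Prop :=
  bijective f /\ forall x y : G, conjugate (f (x * y)) (f x * f y).

Definition automorphism (G : groupType) (f : G -> G) : Prop :=
  bijective f /\ {morph f : x y / x * y}.

(* The subgroup of the group of all bijections of T generated by S, where S
   consists of bijections.  [gen_ext] makes it a set of functions up to
   pointwise equality without assuming functional extensionality. *)
Inductive gen_bij (T : Type) (S : (T -> T) -> Prop) : (T -> T) -> Prop :=
| gen_base f : S f -> gen_bij S f
| gen_id : gen_bij S id
| gen_comp f g : gen_bij S f -> gen_bij S g -> gen_bij S (f \o g)
| gen_inv f g : gen_bij S f -> cancel f g -> cancel g f -> gen_bij S g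
| gen_ext f g : gen_bij S f -> f =1 g -> gen_bij S g.

Definition trivial_weak_cayley_map (G : groupType) : (G -> G) -> Prop :=
  gen_bij (fun f => automorphism f \/ f =1 (fun x : G => x^-1)).

(* Main.v *)
Require Import Defs.
From mathcomp Require Import all_boot all_order all_fingroup all_algebra.
From mathcomp Require Import cyclic.

Set Implicit Arguments.
Unset Strict Implicit.
Unset Printing Implicit Defensive.

(* Write G = N x| H with N abelian and H of odd prime order, and let s be a
   generator of H.  The map that is the identity on N and conjugation by s off N
   is the required one.  The only products for which the weak Cayley property
   needs an argument are those with exactly one factor in N, and these are
   settled by the fact that the class of (a, h) with h <> 1 contains the whole
   coset a (s - 1) N, because s is a power of h.  Trivial maps are either
   automorphisms or anti-automorphisms, and this map being one of these would
   force s or s^2, hence H, to act trivially. *)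

Local Open Scope group_scope.

(* fingroup has a [conjugate] for subsets of finite groups. *)
Local Notation conjugate := Defs.conjugate.

Lemma conjugate_refl (G : groupType) (x : G) : conjugate x x.
Proof. by exists 1; rewrite conjg1. Qed.

Lemma conjugate_trans (G : groupType) (x y z : G) :
  conjugate x y -> conjugate y z -> conjugate x z.
Proof. by move=> [u ->] [v ->]; exists (u * v); rewrite conjgM. Qed.

(** Inversion reverses products; under composition reversals add modulo 2. *)
Lemma trivial_weak_cayley_morph (G : groupType) (f : G -> G) :
  trivial_weak_cayley_map f ->
  {morph f : x y / x * y} \/ {morph f : x y / x * y >-> y * x}.
Proof.
elim=> {f} [f [[_ fM] | fV] | | f g _ IHf _ IHg | f g _ IHf fK gK | f g _ IHf fg].
- by left.
- by right=> x y; rewrite !fV invgM.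
- by left.
- by case: IHf IHg => fM [] gM; [left | right | right | left] => x y /=;
    rewrite gM fM.
- by case: IHf => fM; [left | right] => x y; apply: (can_inj fK);
    rewrite fM !gK.
- by case: IHf => fM; [left | right] => x y; rewrite -!fg fM.
Qed.

Section SemidirectPrimeOrder.

Variables (H : finGroupType) (K : groupType) (phi : autAction H K).
Local Notation sd := (SemiDirect phi).

Lemma aut_actK h : cancel (phi h) (phi h^-1).
Proof.
by move=> x; rewrite -[LHS]/((phi h^-1 \o phi h) x) -aut_actM mulVg aut_act1.
Qed.

Lemma aut_actVK h : cancel (phi h^-1) (phi h).
Proof. by move=> x; rewrite -{1}[h]invgK aut_actK. Qed.

Lemma aut_act_expg_id s j : phi s =1 id -> phi (s ^+ j) =1 id.
Proof.
move=> s1; elim: j => [|j IHj] x; first by rewrite expg0 aut_act1.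
by rewrite expgS aut_actM /= IHj s1.
Qed.

Lemma sdM a h b k : sd a h * sd b k = sd (a * phi h b) (h * k).
Proof. by []. Qed.

Lemma sdV a h : (sd a h)^-1 = sd (phi h^-1 a^-1) h^-1.
Proof. by []. Qed.

Definition twist_off_kernel s (u : semidirect phi) : semidirect phi :=
  if sd_top u == 1 then u else sd (phi s (sd_ker u)) (sd_top u).

Lemma twist_off_kernelK s :
  cancel (twist_off_kernel s) (twist_off_kernel s^-1).
Proof.
case=> a h; rewrite /twist_off_kernel /=; case: (eqVneq h 1) => [->|nh] /=.
  by rewrite eqxx.
by rewrite (negPf nh) aut_actK.
Qed.

Lemma twist_off_kernel_bij s : bijective (twist_off_kernel s).
Proof.
exists (twist_off_kernel s^-1); first exact: twist_off_kernelK.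
by move=> u; rewrite -{1}[s]invgK twist_off_kernelK.
Qed.

Hypotheses (mulKC : commutative (@mulg K)) (prH : prime #|H|).

Lemma prime_cycle (h s : H) : h != 1 -> exists j, s = h ^+ j.
Proof.
move=> nh; apply/cycleP; suff ->: <[h]> = [set: H] by rewrite inE.
apply/eqP; rewrite eqEcard subsetT cardsT /=.
have: #[h] %| #|[set: H]| by rewrite orderE cardSg ?subsetT.
rewrite cardsT; case/primeP: prH => _ /[apply] /orP[]; last by move/eqP <-.
by rewrite order_eq1 (negPf nh).
Qed.

Lemma prime_mulgC : commutative (@mulg H).
Proof.
move=> x y; have [->|ny] := eqVneq y 1; first by rewrite mulg1 mul1g.
by have [j ->] := prime_cycle x ny; rewrite -expgS -expgSr.
Qed.

(** Telescoping: conjugating by [w = phi (h ^+ j) z] multiplies the kernel part by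
    [w^-1 * phi h w]. *)
Lemma conjugate_expg_coset a h z j :
  conjugate (sd a h) (sd (a * (z^-1 * phi (h ^+ j) z)) h).
Proof.
elim: j => [|j IHj].
  by rewrite expg0 aut_act1 mulVg mulg1; exact: conjugate_refl.
apply: conjugate_trans IHj _; set w := phi (h ^+ j) z.
have ->: phi (h ^+ j.+1) z = phi h w by rewrite expgS aut_actM.
exists (sd w 1); rewrite conjgE sdV !sdM !invg1 !aut_act1 mul1g mulg1.
by congr sd; rewrite !mulgA; congr (_ * _); rewrite -!mulgA [w^-1 * _]mulKC -!mulgA mulgV mulg1.
Qed.

Lemma conjugate_coset a h z s :
  h != 1 -> conjugate (sd a h) (sd (a * (z^-1 * phi s z)) h).
Proof. by case/(prime_cycle s) => j ->; exact: conjugate_expg_coset. Qed.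

Lemma aut_actC h k x : phi h (phi k x) = phi k (phi h x).
Proof.
by rewrite -[LHS]/((phi h \o phi k) x) -aut_actM prime_mulgC aut_actM.
Qed.

Lemma twist_off_kernel_weak_cayley s : weak_cayley_map (twist_off_kernel s).
Proof.
split; first exact: twist_off_kernel_bij.
case=> a h [b k]; rewrite /twist_off_kernel sdM /=.
have [->|nh] := eqVneq h 1; have [->|nk] := eqVneq k 1.
- by rewrite sdM mulg1 eqxx; exact: conjugate_refl.
- rewrite mul1g (negPf nk) sdM !aut_act1 mul1g.
  (* With [z = phi s a] and [s^-1], the factor [phi s a] of [phi s (a * b)] turns back into [a]. *)
  have := conjugate_coset (phi s (a * b)) (phi s a) s^-1 nk.
  by rewrite aut_actK aut_act_morph [phi s a * _]mulKC -mulgA mulKVg [_ * a]mulKC.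
- rewrite mulg1 (negPf nh) sdM mulg1.
  have := conjugate_coset (phi s (a * phi h b)) (phi s (phi h b)) s^-1 nh.
  by rewrite aut_actK aut_act_morph -mulgA mulKVg.
- rewrite sdM [phi h (phi s b)]aut_actC -aut_act_morph.
  case: eqP => [->|_]; last exact: conjugate_refl.
  (* Here [h * k = 1]: the product lies in the kernel and is fixed, so the twist by [s] is undone by
     a conjugation. *)
  exists (sd 1 s^-1); rewrite conjgE sdV !sdM invgK mul1g mulgV invg1.
  by rewrite !aut_act_one /= mulg1 mul1g.
Qed.

(** Since [s] generates [H], all of [H] acts trivially and the product is direct. *)
Lemma act_trivial_abelian s :
  s != 1 -> phi s =1 id -> abelian_group (semidirect phi).
Proof.
move=> ns s1 [a h] [b k]; rewrite /commute !sdM prime_mulgC.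
have [[i ->] [j ->]] := (prime_cycle h ns, prime_cycle k ns).
by rewrite !(aut_act_expg_id _ s1) mulKC.
Qed.

Lemma twist_off_kernel_nontrivial s :
  odd #|H| -> s != 1 -> ~ abelian_group (semidirect phi) ->
  ~ trivial_weak_cayley_map (twist_off_kernel s).
Proof.
move=> oddH ns nab /trivial_weak_cayley_morph[] fM; apply: nab.
  apply: (act_trivial_abelian ns) => a.
  have := fM (sd a 1) (sd 1 s).
  rewrite /twist_off_kernel sdM /= mul1g eqxx (negPf ns) sdM !aut_act_one.
  by rewrite !mulg1 => -[].
have ns2: s ^+ 2 != 1.
  rewrite -order_dvdn; apply: contra ns => s2; rewrite -order_eq1 -dvdn1.
  have sH: #[s] %| #|H| by rewrite -cardsT orderE cardSg ?subsetT.
  suff /eqP<-: coprime 2 #|H| by rewrite dvdn_gcd s2.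
  by rewrite coprime2n.
apply: (act_trivial_abelian ns2) => a; rewrite expgS expg1 aut_actM /=.
(* Reversal compares [phi s (phi s a)] with [a]: one [phi s] from the product, one from the
   twist. *)
have := fM (sd 1 s) (sd a 1).
rewrite /twist_off_kernel !sdM /= mulg1 eqxx (negPf ns) sdM !aut_act_one.
by rewrite !mulg1 !mul1g => -[].
Qed.

End SemidirectPrimeOrder.

Local Close Scope group_scope.

(* 'Z_p, as a group, is cyclic of order p (its group law is addition), and
   [Algebra.to_multiplicative 'rV[int]_n] is Z^n with its addition as group law. *)
Theorem theorem1p3 (p n : nat)
    (phi : autAction 'Z_p (Algebra.to_multiplicative 'rV[int]_n)) :
  prime p -> odd p -> (1 <= n)%N ->
  ~ abelian_group (semidirect phi) ->
  exists f : semidirect phi -> semidirect phi,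
    weak_cayley_map f /\ ~ trivial_weak_cayley_map f.
Proof.
move=> pr_p odd_p _ nab.
have cardH: #|'Z_p| = p by rewrite card_ord Zp_cast ?prime_gt1.
have prH: prime #|'Z_p| by rewrite cardH.
have mulKC: commutative (@mulg (Algebra.to_multiplicative 'rV[int]_n)).
  exact: (@GRing.addrC 'rV[int]_n).
(* [Zp1] is the residue 1, not the group identity, which is the residue 0. *)
exists (twist_off_kernel (Zp1 : 'Z_p)); split.
  exact: twist_off_kernel_weak_cayley.
by apply: twist_off_kernel_nontrivial; rewrite ?cardH.
Qed.
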